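(* Let $(X,G)$ be a dynamical system, $d$ a metric on $X$ generating the topology, and $(B_n)$ a F\o lner sequence on $G$. For $x\in X$ the following assertions are equivalent: (i) The point $x$ is mean almost periodic. (ii) Every element of $\mathcal{A}_x$ is a mean almost periodic function. (iii) The set $\{f\in C(X): f_x \text{ is mean almost periodic}\}$ separates the points of the orbit closure $\overline{Gx}$. (iv) For every $s\in G$ the function $d^{(s)}_x$ is mean almost periodic, where $d^{(s)}\in C(X)$ is defined by $d^{(s)}(y):=d(sx,y)$.
   Context: $G$ is a locally compact, $\sigma$-compact abelian group, written additively, with a fixed Haar measure; $|A|$ denotes the Haar measure of $A\subset G$. A dynamical system $(X,G)$ is a compact metrizable space $X$ with a continuous action $G\times X\to X$, $(t,x)\mapsto tx$. $C(X)$ is the set of continuous complex-valued functions on $X$. The orbit of $x$ is $Gx=\{tx:t\in G\}$ and $\overline{Gx}$ is its closure. A F\o lner sequence $(B_n)$ is a sequence of (nonempty) open relatively compact subsets of $G$ with $\frac{|(B_n\setminus(t+B_n))\cup((t+B_n)\setminus B_n)|}{|B_n|}\to 0$ for all $t\in G$. For bounded measurable $h:G\to\mathbb{R}$ let $\overline{M}(h)=\limsup_{n\to\infty}\frac{1}{|B_n|}\int_{B_n}h(s)\,\mathrm{d}s$. A subset $A\subset G$ is relatively dense if there is a compact $K\subset G$ with $G=\bigcup_{a\in A}(a+K)$. A point $x\in X$ is mean almost periodic (with respect to $(B_n)$) if for every $\varepsilon>0$ the set $\{t\in G: D(x,tx)<\varepsilon\}$ is relatively dense, where $D(x,y)=\overline{M}(s\mapsto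 d(sx,sy))$; this does not depend on the choice of the metric generating the topology. A bounded measurable function $g:G\to\mathbb{C}$ is mean almost periodic (with respect to $(B_n)$) if for every $\varepsilon>0$ the set $\{t\in G:\overline{M}(|g-g(\cdot-t)|)<\varepsilon\}$ is relatively dense. For $x\in X$ and $f\in C(X)$, $f_x:G\to\mathbb{C}$ is the function $f_x(t)=f(tx)$, and $\mathcal{A}_x=\{f_x: f\in C(X)\}$. *)

(* Defs.v *)
(* The complex numbers are R[i]^o for R : realType: R[i] itself carries no
   topology, while R[i]^o has that of the modulus.  The modulus on R[i] is
   R[i]-valued, hence Normc.normc where a real number is needed. *)
From HB Require Import structures.
From mathcomp Require Import all_boot all_order all_algebra.
From mathcomp Require Import all_classical all_reals all_analysis.
From mathcomp Require Export complex.

Set Implicit Arguments.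
Unset Strict Implicit.
Unset Printing Implicit Defensive.

Import Order.TTheory GRing.Theory Num.Theory.
Import numFieldNormedType.Exports.

Local Open Scope classical_set_scope.
Local Open Scope ring_scope.

(* Measurable types are pointed; topologicalZmodType does not provide this. *)
#[non_forgetful_inheritance]
HB.instance Definition _ (G : topologicalZmodType) := isPointed.Build G 0.

Notation borel T := (g_sigma_algebraType (@open T)).

Section Group.
Context {R : realType} {G : topologicalZmodType}.
Implicit Types (mu : {measure set (borel G) -> \bar R}) (B : (set G)^nat).

Definition sigma_compact (T : topologicalType) :=
  exists2 K : (set T)^nat, (forall n, compact (K n)) & \bigcup_n K n = [set: T].

Definition translate (t : G) (A : set G) : set G := [set t + a | a in A].

(* A nonzero translation-invariant Radon measure on the Borel sets. *)
Record haar_measure mu : Prop := {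
  haar_neq0 : mu [set: G] != 0%E ;
  haar_compact_fin : forall K : set G, compact K -> (mu K < +oo)%E ;
  haar_translate : forall (t : G) (A : set (borel G)),
    measurable A -> mu (translate t A) = mu A ;
  haar_outer_regular : forall A : set (borel G), measurable A ->
    mu A = ereal_inf [set mu U | U in [set U : set G | open U /\ A `<=` U]] ;
  haar_inner_regular : forall U : set G, open U ->
    mu U = ereal_sup [set mu K | K in [set K : set G | compact K /\ K `<=` U]]
}.

Record folner_sequence mu B : Prop := {
  folner_open : forall n, open (B n) ;
  folner_precompact : forall n, precompact (B n) ;
  folner_neq0 : forall n, B n !=set0 ;
  folner_invariant : forall t : G,
    (fun n => fine (mu (B n `+` translate t (B n))) / fine (mu (B n)))
      @ \oo --> (0 : R)
}.

(* Valued in \bar R, so that the limsup needs no boundedness side condition. *)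
Definition upper_mean mu B (h : G -> R) : \bar R :=
  limn_esup (fun n =>
    ((fine (mu (B n)))^-1 * \int[mu]_(s in B n) h s)%:E).

Definition relatively_dense (A : set G) :=
  exists2 K : set G, compact K & \bigcup_(a in A) translate a K = [set: G].

Definition mean_almost_periodic_fun mu B (g : G -> R[i]^o) :=
  [/\ exists M : R, forall t, Normc.normc (g t) <= M,
      measurable_fun [set: borel G] (g : borel G -> borel R[i]^o)
    & forall eps : R, 0 < eps -> relatively_dense
        [set t | (upper_mean mu B (fun s => Normc.normc (g s - g (s - t))%R)
                  < eps%:E)%E]].

Section System.
(* A metricType is a topological space with a metric, mdist, generating its
   topology: X stands for the pair (X, d). *)
Context {X : metricType R}.
Implicit Types (act : G -> X -> X) (x y : X).

Record continuous_action act : Prop := {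
  action0 : forall x, act 0 x = x ;
  actionD : forall s t x, act (s + t) x = act s (act t x) ;
  action_continuous : continuous (fun p : G * X => act p.1 p.2)
}.

Definition action_orbit act x : set X := range (act ^~ x).

Definition mean_dist mu B act x y : \bar R :=
  upper_mean mu B (fun s => mdist (act s x) (act s y)).

Definition mean_almost_periodic_point mu B act x :=
  forall eps : R, 0 < eps ->
    relatively_dense [set t | (mean_dist mu B act x (act t x) < eps%:E)%E].

Definition continuous_functions : set (X -> R[i]^o) :=
  [set f | continuous f].

Definition along_orbit act x (f : X -> R[i]^o) : G -> R[i]^o :=
  fun t => f (act t x).

Definition orbit_functions act x : set (G -> R[i]^o) :=
  [set along_orbit act x f | f in continuous_functions].

Definition separates_points_of (F : set (X -> R[i]^o)) (A : set X) :=
  forall y z, A y -> A z -> y <> z -> exists2 f, F f & f y <> f z.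

Definition dist_from act x (s : G) : X -> R[i]^o :=
  fun y => real_complex R (mdist (act s x) y).

End System.
End Group.

(* Main.v *)
(* Everything is phrased through continuous pseudometrics k on X: the points t
   with limsup of the means of s |-> k (s x, (s - t) x) below e are the e-almost
   periods of k.  Taking k = d gives mean almost periodicity of x, taking
   k (y, z) = |f y - f z| that of f_x.  As orbit maps are uniformly continuous,
   a relatively dense set of almost periods has finitely many translates
   covering G (after enlarging e); by pigeonhole, two such k then have
   sufficiently many common almost periods, so that k1 + k2 is mean almost
   periodic along x if k1 and k2 are.  If a family of such k separates the points
   of the orbit closure, then by compactness every continuous pseudometric is, up
   to e, dominated on the orbit by a finite combination of the family, and so is
   itself mean almost periodic along x.  All implications follow from this,
   without the Stone-Weierstrass theorem. *)
From HB Require Import structures.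
Require Import Defs.
From mathcomp Require Import all_boot all_order all_algebra.
From mathcomp Require Import all_classical all_reals all_analysis.
From mathcomp Require Import measurable_realfun lra.
Import Order.TTheory GRing.Theory Num.Theory.
Import numFieldNormedType.Exports.
Local Open Scope classical_set_scope.
Local Open Scope ring_scope.

(** * Relatively dense sets and coverings of [G] by finitely many translates *)

Section SyndeticSets.
Set Implicit Arguments.
Unset Strict Implicit.
Context {G : topologicalZmodType}.
Implicit Types (A U V W : set G) (t : G).

Lemma relatively_denseP A :
  relatively_dense A <-> exists2 K : set G, compact K &
    forall t, exists2 a, A a & K (t - a).
Proof.
split=> -[K cK AK]; exists K => //.
  move=> t; have : [set: G] t by [].
  rewrite -AK => -[a Aa [k Kk <-]]; exists a => //.
  by rewrite addrC addKr.
rewrite -subTset => t _; have [a Aa Ka] := AK t.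
by exists a => //; exists (t - a) => //; rewrite addrC subrK.
Qed.

Lemma relatively_denseS A V : A `<=` V -> relatively_dense A ->
  relatively_dense V.
Proof.
move=> AV /relatively_denseP[K cK AK]; apply/relatively_denseP.
by exists K => // t; have [a /AV] := AK t; exists a.
Qed.

(** [- K] serves for [- A]. Needed because [mean_dist] compares [s x] with [(s + t) x], mean almost
    periodicity of functions [s] with [s - t]. *)
Lemma relatively_denseN A : relatively_dense A ->
  relatively_dense [set t | A (- t)].
Proof.
move=> /relatively_denseP[K cK AK]; apply/relatively_denseP.
exists [set - k | k in K].
  apply: continuous_compact => //; apply: continuous_subspaceT.
  exact: opp_continuous.
move=> t; have [a Aa Ka] := AK (- t); exists (- a); first by rewrite /= opprK.
by exists (- t - a) => //; rewrite opprB !opprK addrC.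
Qed.

(** Relative density with a finite set in place of the compact one, which makes the pigeonhole
    principle available. *)
Definition finitely_covering V :=
  exists s : seq G, forall t, exists2 a, a \in s & V (t - a).

Lemma finitely_covering_relatively_dense V :
  finitely_covering V -> relatively_dense V.
Proof.
move=> [s sV]; apply/relatively_denseP; exists [set` s].
  exact/finite_compact/finite_seq.
by move=> t; have [a sa Va] := sV t; exists (t - a) => //=; rewrite subKr.
Qed.

Lemma continuous_addr_cst (a : G) : continuous (fun t : G => t + a).
Proof.
move=> t.
apply: (@continuous_comp _ _ _ (fun u : G => (u, a)) (fun p => p.1 + p.2)).
  by apply: cvg_pair => //; exact: cvg_cst.
exact: add_continuous.
Qed.

(** Each [t - a] lies in [K] for some [a] in [A], and finitely many translates [k + U] cover [K];
    then [t - k] lies in [A + U]. *)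
Lemma relatively_dense_thicken A U V : relatively_dense A -> nbhs 0 U ->
  (forall a u, A a -> U u -> V (a + u)) -> finitely_covering V.
Proof.
move=> /relatively_denseP[K cK AK] U0 AUV.
move: cK; rewrite compact_cover => /(_ _ K (fun k => [set t | U^° (t - k)])).
case.
- move=> k _; rewrite -[X in open X]/((fun t : G => t - k) @^-1` U^°).
  apply: open_comp; last exact: open_interior.
  by move=> t _; exact: continuous_addr_cst.
- move=> k Kk; exists k => //=; rewrite subrr; exact: U0.
- move=> D DK KD; exists (finmap.enum_fset D) => t.
  have [a Aa Ka] := AK t; have [k Dk /interior_subset/= Uk] := KD _ Ka.
  exists k => //; rewrite (_ : t - k = a + (t - a - k)).
    exact: AUV.
  by rewrite addrA subrKC.
Qed.

(* Sort [G] by which translates of [V1] and [V2] contain a point; two points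
   of the same class differ by an element of both difference sets. *)
Lemma finitely_coveringI V1 V2 W :
  finitely_covering V1 -> finitely_covering V2 ->
  (forall a b s t, V1 (s - a) -> V1 (t - a) -> V2 (s - b) -> V2 (t - b) ->
    W (s - t)) ->
  finitely_covering W.
Proof.
move=> [s1 s1V] [s2 s2V] VW.
(* A representative of each class; the default 0 occurs only for empty classes, which contain no
   [t]. *)
pose r a b := xget 0 [set t | V1 (t - a) /\ V2 (t - b)].
exists [seq r a b | a <- s1, b <- s2] => t.
have [a as1 Va] := s1V t; have [b bs2 Vb] := s2V t.
exists (r a b); first by apply/allpairsP; exists (a, b).
have [ra rb] : V1 (r a b - a) /\ V2 (r a b - b).
  by rewrite /r; case: xgetP => // /(_ t) []; split.
exact: VW Va ra Vb rb.
Qed.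

End SyndeticSets.

(** * Means of bounded continuous functions along the Følner sequence *)

Section FolnerMeans.
Set Implicit Arguments.
Unset Strict Implicit.

Lemma open_borel_measurable {T : ptopologicalType} (U : set T) :
  open U -> measurable (U : set (borel T)).
Proof. by move=> oU; exact: sub_sigma_algebra. Qed.

Lemma continuous_borel_measurable {T U : ptopologicalType} (f : T -> U) :
  continuous f -> measurable_fun [set: borel T] (f : borel T -> borel U).
Proof.
move=> /continuousP cf; apply:
  (@measurability _ _ (borel T) (borel U) setT f (@open U)) => //.
by move=> _ [V oV <-]; rewrite setTI; apply: open_borel_measurable; exact: cf.
Qed.

Context {R : realType} {G : topologicalZmodType}.
Variable mu : {measure set (borel G) -> \bar R}.
Variable B : (set G)^nat.
Hypothesis mu_haar : haar_measure mu.
Hypothesis B_folner : folner_sequence mu B.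
Implicit Types (h : G -> R) (e : R).

Definition bounded_continuous h :=
  continuous h /\ exists M, forall s, `|h s| <= M.

Lemma bounded_continuousD h1 h2 : bounded_continuous h1 ->
  bounded_continuous h2 -> bounded_continuous (fun s => h1 s + h2 s).
Proof.
move=> [ch1 [M1 hM1]] [ch2 [M2 hM2]]; split.
  by move=> s; apply: continuousD; [exact: ch1|exact: ch2].
by exists (M1 + M2) => s; rewrite (le_trans (ler_normD _ _))// lerD.
Qed.

Lemma bounded_continuous_cst (c : R) : bounded_continuous (fun=> c).
Proof. by split; [move=> s; exact: cvg_cst|exists `|c|]. Qed.

Lemma bounded_continuous_shift h t : bounded_continuous h ->
  bounded_continuous (fun s => h (s + t)).
Proof.
move=> [ch [M hM]]; split; last by exists M => s.
move=> s; apply: (@continuous_comp _ _ _ (fun s : G => s + t) h).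
  exact: continuous_addr_cst.
exact: ch.
Qed.

Lemma continuous_measurable_real h :
  continuous h -> measurable_fun [set: borel G] (h : borel G -> R).
Proof.
move=> /continuousP ch; apply: (measurability _ (RGenOpens.measurableE R)).
move=> _ [_ [a [b ->] <-]]; rewrite setTI.
apply: open_borel_measurable; exact/ch/interval_open.
Qed.

Lemma bounded_continuous_integrable h (A : set (borel G)) :
  bounded_continuous h -> measurable A -> (mu A < +oo)%E ->
  mu.-integrable A (EFin \o h).
Proof.
move=> [ch [M hM]] mA Afin; apply: measurable_bounded_integrable => //.
  by apply: measurable_funTS; exact: continuous_measurable_real.
by exists M; split=> [|N MN s As]; rewrite ?num_real//= (le_trans (hM s))// ltW.
Qed.

Lemma folner_measurable n : measurable (B n : set (borel G)).
Proof. apply: open_borel_measurable; exact: folner_open B_folner n. Qed.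

Lemma translate_preimage t (A : set G) : translate t A = (+%R^~ (- t)) @^-1` A.
Proof.
apply/seteqP; split => s /=; first by move=> [a Aa <-]; rewrite addrAC subrr add0r.
by exists (s - t) => //; rewrite addrC subrK.
Qed.

Lemma translate_measurable t (A : set (borel G)) :
  measurable A -> measurable (translate t A : set (borel G)).
Proof.
move=> mA; rewrite translate_preimage -[X in measurable X]setTI.
exact: (continuous_borel_measurable (@continuous_addr_cst G (- t))).
Qed.

Lemma folner_finite n : (mu (B n) < +oo)%E.
Proof.
apply: le_lt_trans (haar_compact_fin mu_haar (K := closure (B n)) _); last first.
  by rewrite -precompactE; exact: folner_precompact B_folner n.
apply: le_measure; rewrite ?inE; [exact: folner_measurable| |exact: subset_closure].
rewrite -[X in measurable X]setCK; apply: measurableC.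
by apply: open_borel_measurable; rewrite openC; exact: closed_closure.
Qed.

Let folner_integrable h n : bounded_continuous h ->
  mu.-integrable (B n : set (borel G)) (EFin \o h).
Proof.
move=> bh; apply: bounded_continuous_integrable => //.
- exact: folner_measurable.
- exact: folner_finite.
Qed.

Definition folner_mean h n : R :=
  (fine (mu (B n)))^-1 * \int[mu]_(s in B n) h s.

Lemma folner_mean_le h1 h2 n : bounded_continuous h1 -> bounded_continuous h2 ->
  (forall s, h1 s <= h2 s) -> folner_mean h1 n <= folner_mean h2 n.
Proof.
move=> b1 b2 h12; rewrite ler_wpM2l// ?invr_ge0 ?fine_ge0//.
by apply: le_Rintegral => //; [exact: folner_measurable|exact: folner_integrable..].
Qed.

Lemma folner_meanD h1 h2 n : bounded_continuous h1 -> bounded_continuous h2 ->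
  folner_mean (fun s => h1 s + h2 s) n = folner_mean h1 n + folner_mean h2 n.
Proof.
move=> b1 b2; rewrite /folner_mean RintegralD ?mulrDr//;
  by [exact: folner_measurable|exact: folner_integrable].
Qed.

Lemma folner_meanZ h c n : bounded_continuous h ->
  folner_mean (fun s => c * h s) n = c * folner_mean h n.
Proof.
move=> bh; rewrite /folner_mean RintegralZl 1?mulrCA//;
  by [exact: folner_measurable|exact: folner_integrable].
Qed.

(** The mean is [c] unless [fine (mu (B n)) = 0], when it is 0; hence an inequality. *)
Lemma folner_mean_cst_le c n : 0 <= c -> folner_mean (fun=> c) n <= c.
Proof.
move=> c0; rewrite /folner_mean Rintegral_cst; last exact: folner_measurable.
have [->|mu0] := eqVneq (fine (mu (B n))) 0; first by rewrite !mulr0.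
by rewrite mulrCA mulVf ?mulr1.
Qed.

(** Stands in for [upper_mean mu B h < e]: it follows from it and implies the bound by every larger
    [e']. Eventual inequalities can be added without handling limsups. *)
Definition mean_below h e := \forall n \near \oo, folner_mean h n < e.

Lemma upper_mean_lt h e : (upper_mean mu B h < e%:E)%E -> mean_below h e.
Proof.
(* The limsup is the infimum, over the sets [V] of the filter, of the suprema over [V]. *)
move=> /ereal_inf_lt[_ [V FV <-]] supV; apply: filterS FV => n Vn.
rewrite /= -lte_fin; apply: le_lt_trans supV; apply: ereal_sup_ubound.
by exists n.
Qed.

Lemma mean_below_upper_mean h e e' : mean_below h e -> e < e' ->
  (upper_mean mu B h < e'%:E)%E.
Proof.
move=> he ee'; apply: (@le_lt_trans _ _ e%:E); last by rewrite lte_fin.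
apply: ge_ereal_inf.
exists (ereal_sup
  ((fun n => (folner_mean h n)%:E) @` [set n | folner_mean h n < e])).
  by exists [set n | folner_mean h n < e].
by apply: ge_ereal_sup => _ [n hn <-]; rewrite lee_fin ltW.
Qed.

Lemma mean_below_le h1 h2 e1 e2 : bounded_continuous h1 ->
  bounded_continuous h2 -> (forall s, h1 s <= h2 s) -> e2 <= e1 ->
  mean_below h2 e2 -> mean_below h1 e1.
Proof.
move=> b1 b2 h12 e21; apply: filterS => n he.
exact: le_lt_trans (folner_mean_le n b1 b2 h12) (lt_le_trans he e21).
Qed.

Lemma mean_belowD h1 h2 e1 e2 : bounded_continuous h1 ->
  bounded_continuous h2 -> mean_below h1 e1 -> mean_below h2 e2 ->
  mean_below (fun s => h1 s + h2 s) (e1 + e2).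
Proof.
by move=> b1 b2; apply: filterS2 => n he1 he2; rewrite folner_meanD// ltrD.
Qed.

Lemma mean_below_leD h h1 h2 e e1 e2 : bounded_continuous h ->
  bounded_continuous h1 -> bounded_continuous h2 ->
  mean_below h1 e1 -> mean_below h2 e2 ->
  (forall s, h s <= h1 s + h2 s) -> e1 + e2 <= e -> mean_below h e.
Proof.
move=> b b1 b2 m1 m2 hle ele.
by apply: mean_below_le (mean_belowD b1 b2 m1 m2) => //; exact: bounded_continuousD.
Qed.

Lemma mean_belowZ h c e : bounded_continuous h -> 0 < c -> mean_below h e ->
  mean_below (fun s => c * h s) (c * e).
Proof.
by move=> bh c0; apply: filterS => n he; rewrite folner_meanZ// ltr_pM2l.
Qed.

Lemma mean_below_cst c e : 0 <= c -> c < e -> mean_below (fun=> c) e.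
Proof.
by move=> c0 ce; apply: nearW => n; exact: le_lt_trans (folner_mean_cst_le n c0) ce.
Qed.

(** Change of variables: by invariance [s |-> s + t] pushes [mu] forward to itself, and [B n] is the
    preimage of [t + B n]. *)
Let Rintegral_shift h t n : bounded_continuous h ->
  \int[mu]_(s in B n) h (s + t) = \int[mu]_(s in translate t (B n)) h s.
Proof.
move=> bh; have mB := folner_measurable n.
have mT := translate_measurable t mB.
have mS : measurable_fun [set: borel G] ((fun s => s + t) : borel G -> borel G).
  apply: continuous_borel_measurable; exact: continuous_addr_cst.
have BE : (fun s : G => s + t) @^-1` translate t (B n) = B n.
  by rewrite translate_preimage; apply/seteqP; split => s /=; rewrite addrK.
congr fine; rewrite -[in LHS]BE.
rewrite -(@integral_pushforward _ _ _ _ _ _ mS mu _ (EFin \o h))//.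
- apply: eq_measure_integral => A mA _.
  rewrite /pushforward -(haar_translate mu_haar (- t) mA) translate_preimage.
  by rewrite opprK.
- by apply/measurable_EFinP; apply: continuous_measurable_real; case: bh.
- rewrite BE; exact: folner_integrable (bounded_continuous_shift t bh).
Qed.

(** The shifted integral is one over [t + B n], which exceeds [B n] by a part of the symmetric
    difference only, and there [h <= M]. *)
Lemma folner_mean_shift h t M n : bounded_continuous h ->
  (forall s, 0 <= h s <= M) ->
  folner_mean (fun s => h (s + t)) n <= folner_mean h n +
    M * (fine (mu (B n `+` translate t (B n))) / fine (mu (B n))).
Proof.
move=> bh hM; rewrite /folner_mean Rintegral_shift//.
set T := translate t (B n).
have mB := folner_measurable n.
have mT : measurable (T : set (borel G)) := translate_measurable t mB.
have mTB : measurable (T `\` B n : set (borel G)) := measurableD mT mB.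
have mY : measurable (B n `+` T : set (borel G)).
  by rewrite setY_def; apply: measurableU => //; exact: measurableD.
have Bfin := folner_finite n.
have Tfin : (mu T < +oo)%E by rewrite (haar_translate mu_haar).
have Ufin : (mu (B n `|` T) < +oo)%E.
  apply: le_lt_trans (measureU2 mu mB mT) _; exact: lte_add_pinfty.
have Dfin : (mu (B n `+` T) < +oo)%E.
  apply: le_lt_trans Ufin; apply: le_measure; rewrite ?inE.
  - exact: mY.
  - exact: measurableU.
  - by move=> s [[]|[]]; [left|right].
have TBfin : (mu (T `\` B n) < +oo)%E.
  by apply: le_lt_trans Tfin; apply: le_measure; rewrite ?inE.
have M0 : 0 <= M by have /andP[] := hM 0; exact: le_trans.
have UE : B n `|` T = B n `|` (T `\` B n).
  apply/seteqP; split => s [Bs|]; [by left| |by left|by move=> []; right].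
  by have [|nBs] := pselect (B n s); [left|right].
(* As [h >= 0], enlarging the domain increases the integral. *)
have le1 : \int[mu]_(s in T) h s <= \int[mu]_(s in B n `|` T) h s.
  have mU := measurableU _ _ mB mT.
  apply: fine_le.
  - exact: (integrable_fin_num mT (bounded_continuous_integrable bh mT Tfin)).
  - exact: (integrable_fin_num mU (bounded_continuous_integrable bh mU Ufin)).
  - apply: ge0_subset_integral => //.
    + apply: measurable_funTS; apply/measurable_EFinP.
      by apply: continuous_measurable_real; case: bh.
    + by move=> s _; rewrite lee_fin; have /andP[] := hM s.
have le2 : \int[mu]_(s in T `\` B n) h s <= M * fine (mu (B n `+` T)).
  apply: (@le_trans _ _ (\int[mu]_(s in T `\` B n) M)).
    apply: le_Rintegral => //.
    - exact: bounded_continuous_integrable.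
    - exact: (bounded_continuous_integrable (bounded_continuous_cst M)).
    - by move=> s _; have /andP[] := hM s.
  rewrite Rintegral_cst// ler_wpM2l// fine_le ?ge0_fin_numE//.
  apply: le_measure; rewrite ?inE//.
  by move=> s; right.
rewrite mulrA [X in _ + X]mulrC -mulrDr.
rewrite ler_wpM2l// ?invr_ge0 ?fine_ge0//; apply: le_trans le1 _.
rewrite UE Rintegral_setU//; first exact: lerD.
  by rewrite -UE; apply: bounded_continuous_integrable => //; exact: measurableU.
apply/disj_setPS => s [Bs [_ nBs]]; exact: nBs.
Qed.

(** The error of the shift is [M] times the Følner ratio, which tends to 0 and so is eventually
    below [e' - e]. *)
Lemma mean_below_shift h t e e' : bounded_continuous h ->
  (forall s, 0 <= h s) -> e < e' -> mean_below h e ->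
  mean_below (fun s => h (s + t)) e'.
Proof.
move=> bh h0 ee'; have [_ [M hM]] := bh.
have hM' s : 0 <= h s <= M by rewrite h0/= -[h s]ger0_norm.
have M0 : 0 <= M by have /andP[] := hM' 0; exact: le_trans.
have small : \forall n \near \oo,
    M * (fine (mu (B n `+` translate t (B n))) / fine (mu (B n))) < e' - e.
  have : (fun n => M * (fine (mu (B n `+` translate t (B n))) / fine (mu (B n))))
      @ \oo --> (M * 0 : R).
    by apply: cvgMr; exact: folner_invariant B_folner t.
  by rewrite mulr0 => /cvgr_lt; apply; rewrite subr_gt0.
apply: filterS2 small => n rn hn.
by apply: le_lt_trans (folner_mean_shift _ _ bh hM') _; rewrite -(subrKC e e') ltrD.
Qed.

End FolnerMeans.

(** * Continuous pseudometrics on [X] *)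

Section Pseudometrics.
Set Implicit Arguments.
Unset Strict Implicit.
Context {R : realType} {X : metricType R}.
Implicit Types k : X -> X -> R.

Record continuous_pseudometric k : Prop := {
  pseudometricxx : forall y, k y y = 0 ;
  pseudometric_sym : forall y z, k y z = k z y ;
  pseudometric_triangle : forall y z w, k y w <= k y z + k z w ;
  pseudometric_continuous : continuous (fun p : X * X => k p.1 p.2)
}.

Lemma pseudometric_ge0 k y z : continuous_pseudometric k -> 0 <= k y z.
Proof.
move=> pk; have := pseudometric_triangle pk y z y.
by rewrite (pseudometricxx pk) (pseudometric_sym pk z) -mulr2n pmulrn_lge0.
Qed.

Lemma pseudometric_bounded k : compact [set: X] -> continuous_pseudometric k ->
  exists2 M, 0 < M & forall y z, k y z <= M.
Proof.
move=> cX pk.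
have cXX : compact [set: X * X] by rewrite -setXTT; exact: compact_setX.
have : compact [set k p.1 p.2 | p in [set: X * X]].
  apply: continuous_compact => //; apply: continuous_subspaceT.
  exact: pseudometric_continuous.
(* Only numbers strictly above [M] are known to be bounds; the maximum with 0 makes the bound
   positive, so that it can later be a scaling factor. *)
move=> /compact_bounded[M [_ hM]]; exists (Num.max M 0 + 1).
  by rewrite ltr_wpDl// le_max lexx orbT.
move=> y z; rewrite (le_trans (ler_norm _))//.
apply: (hM (Num.max M 0 + 1)); last by exists (y, z).
by rewrite ltr_pwDr// le_max lexx.
Qed.

Lemma continuous_pseudometric0 : continuous_pseudometric (fun _ _ => 0).
Proof. by split=> // p; exact: cvg_cst. Qed.

Lemma continuous_pseudometricD k1 k2 : continuous_pseudometric k1 ->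
  continuous_pseudometric k2 -> continuous_pseudometric (fun y z => k1 y z + k2 y z).
Proof.
move=> p1 p2; split=> [y|y z|y z w|p].
- by rewrite !pseudometricxx// addr0.
- by rewrite (pseudometric_sym p1) (pseudometric_sym p2).
- by rewrite addrACA lerD// pseudometric_triangle.
- by apply: continuousD; exact: pseudometric_continuous.
Qed.

Lemma continuous_pseudometricZ k c : 0 <= c -> continuous_pseudometric k ->
  continuous_pseudometric (fun y z => c * k y z).
Proof.
move=> c0 pk; split=> [y|y z|y z w|p].
- by rewrite pseudometricxx// mulr0.
- by rewrite (pseudometric_sym pk).
- by rewrite -mulrDr ler_wpM2l// pseudometric_triangle.
- by apply: continuousM; [exact: cvg_cst|exact: pseudometric_continuous].
Qed.

(** Since [|k y z - k y' z'| <= k y y' + k z z'], joint continuity reduces to smallness near the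
    diagonal. *)
Lemma continuous_pseudometricP k : (forall y, k y y = 0) ->
  (forall y z, k y z = k z y) -> (forall y z w, k y w <= k y z + k z w) ->
  (forall y e, 0 < e -> \forall z \near y, k y z < e) ->
  continuous_pseudometric k.
Proof.
move=> kxx ksym ktri knear; split=> // -[y z].
apply/cvgrPdist_lt => /= e e0.
have e20 : 0 < e / 2 by rewrite divr_gt0.
have ny : \forall p \near (y, z), k y p.1 < e / 2.
  exact: (cvg_fst (knear y _ e20)).
have nz : \forall p \near (y, z), k z p.2 < e / 2.
  exact: (cvg_snd (knear z _ e20)).
apply: filterS2 ny nz => -[y' z'] /= yy' zz'.
have h1 := ktri y y' z; have h2 := ktri y' z' z.
have h3 := ktri y' y z'; have h4 := ktri y z z'.
rewrite (ksym z' z) in h2; rewrite (ksym y' y) in h3.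
by rewrite ltr_norml; apply/andP; split; lra.
Qed.

Lemma continuous_pseudometric_mdist :
  continuous_pseudometric (fun y z : X => mdist y z).
Proof.
apply: continuous_pseudometricP => [y|y z|y z w|y e e0].
- exact: mdistxx.
- exact: metric_sym.
- exact: metric_triangle.
- by have := nbhsx_ballx y e e0; rewrite ballEmdist.
Qed.

Definition modulus_kernel (f : X -> R[i]^o) y z : R := Normc.normc (f y - f z).

Lemma continuous_pseudometric_modulus (f : X -> R[i]^o) :
  continuous f -> continuous_pseudometric (modulus_kernel f).
Proof.
have normcB (a b : R[i]) : Normc.normc (a - b) = Normc.normc (b - a).
  by rewrite -[LHS](normcN (a - b)) opprB.
have tri (a b c : R[i]) :
    Normc.normc (a - c) <= Normc.normc (a - b) + Normc.normc (b - c).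
  rewrite (_ : a - c = (a - b) + (b - c)); first exact: le_normcD.
  by rewrite addrA subrK.
move=> cf; apply: continuous_pseudometricP => [y|y z|y z w|y e e0].
- by rewrite /modulus_kernel subrr Normc.normc0.
- exact: normcB.
- exact: tri.
- have /cvgrPdist_lt/(_ e%:C%C) := cf y.
  rewrite ltcR => /(_ e0); apply: filterS => z.
  by rewrite (_ : `|_| = (Normc.normc (f y - f z))%:C%C) ?ltcR.
Qed.

End Pseudometrics.

(** * Mean almost periods of a pseudometric along the orbit of [x] *)

Section MeanAlmostPeriods.
Set Implicit Arguments.
Unset Strict Implicit.
Context {R : realType} {G : topologicalZmodType} {X : metricType R}.
Variable mu : {measure set (borel G) -> \bar R}.
Variable B : (set G)^nat.
Variable act : G -> X -> X.
Variable x : X.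
Hypothesis mu_haar : haar_measure mu.
Hypothesis B_folner : folner_sequence mu B.
Hypothesis X_compact : compact [set: X].
Hypothesis act_continuous : continuous_action act.
Implicit Types (k : X -> X -> R) (s t : G) (e : R).

(** The sign of [t] is that of [mean_almost_periodic_fun]: for [modulus_kernel f] this is the
    function averaged there. *)
Definition displacement k t : G -> R := fun s => k (act s x) (act (s - t) x).

Definition mean_almost_periods k e : set G :=
  [set t | mean_below mu B (displacement k t) e].

Definition mean_almost_periodic_along k :=
  forall e, 0 < e -> relatively_dense (mean_almost_periods k e).

Lemma continuous_orbit_map y : continuous (act ^~ y).
Proof.
move=> t; apply: (@continuous_comp _ _ _ (fun t => (t, y)) (fun p => act p.1 p.2)).
  by apply: cvg_pair => //; exact: cvg_cst.
exact: action_continuous.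
Qed.

Lemma displacement_bounded_continuous k t : continuous_pseudometric k ->
  bounded_continuous (displacement k t).
Proof.
move=> pk; split; last first.
  have [M _ hM] := pseudometric_bounded X_compact pk.
  by exists M => s; rewrite ger0_norm ?hM// pseudometric_ge0.
move=> s; apply: (@continuous_comp _ _ _ (fun s => (act s x, act (s - t) x))
  (fun p => k p.1 p.2)); last exact: pseudometric_continuous.
apply: cvg_pair; first exact: continuous_orbit_map.
apply: (@continuous_comp _ _ _ (fun s => s - t) (act ^~ x)).
  exact: (@continuous_addr_cst G (- t) s).
exact: continuous_orbit_map.
Qed.

(* Compactness of [X] makes the action of small [u] uniformly close to the
   identity, hence orbit maps uniformly continuous, [G] being abelian. *)
Lemma near0_uniformly_close k e : continuous_pseudometric k -> 0 < e ->
  \forall u \near 0, forall y, k y (act (- u) y) < e.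
Proof.
move=> pk e0.
(* By compactness it suffices that the inequality holds for all pairs near [(0, y)], for each [y];
   at [(0, y)] itself the left side is 0. *)
have /compact_near_coveringP/(_ G (nbhs 0)
  (fun u y => k y (act (- u) y) < e) _) := X_compact.
have cont : continuous (fun p : X * G => k p.1 (act (- p.2) p.1)).
  move=> p; apply: (@continuous_comp _ _ _
    (fun p : X * G => (p.1, act (- p.2) p.1)) (fun q => k q.1 q.2)).
    apply: cvg_pair; first exact: cvg_fst.
    apply: (@continuous_comp _ _ _ (fun p : X * G => (- p.2, p.1))
      (fun q => act q.1 q.2)); last exact: action_continuous.
    apply: cvg_pair; last exact: cvg_fst.
    apply: (@continuous_comp _ _ _ snd (@GRing.opp G)); first exact: cvg_snd.
    exact: opp_continuous.
  exact: pseudometric_continuous.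
move=> cover; apply: filterS (cover _) => [u uX y|y _]; first exact: uX.
have : k y (act (- 0) y) < e.
  by rewrite oppr0 (action0 act_continuous) (pseudometricxx pk).
have /cvgr_lt/[apply] := cont (y, 0).
exact.
Qed.

(** As [(s - (a + u)) x = (- u) ((s - a) x)], adding a small [u] to an almost period [a] costs
    uniformly little, so thickening applies. *)
Lemma mean_almost_periods_finitely_covering k e : continuous_pseudometric k ->
  mean_almost_periodic_along k -> 0 < e ->
  finitely_covering (mean_almost_periods k e).
Proof.
move=> pk mk e0; have e2 : 0 < e / 2 by rewrite divr_gt0.
have e4 : 0 < e / 4 by rewrite divr_gt0.
apply: relatively_dense_thicken (mk _ e2) (near0_uniformly_close pk e4) _.
move=> a u ma uX; have e42 : e / 4 < e / 2 by lra.
apply: (mean_below_leD mu_haar B_folner (displacement_bounded_continuous _ pk)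
  (displacement_bounded_continuous a pk) (bounded_continuous_cst (e / 4)) ma
  (mean_below_cst B_folner (ltW e4) e42)).
- move=> s; apply: le_trans (pseudometric_triangle pk _ (act (s - a) x) _) _.
  rewrite lerD2l ltW// (_ : s - (a + u) = - u + (s - a)).
    by rewrite [act (- u + _) x](actionD act_continuous); exact: uX.
  by rewrite opprD addrA addrC.
- by rewrite -splitr.
Qed.

(** Go from [r x] to [(r - s + t) x] through [(r - s) x]; the second leg is the displacement by [t],
    evaluated at [r + (t - s)]. *)
Lemma mean_almost_periodsB k e e' s t : continuous_pseudometric k ->
  2 * e < e' -> mean_almost_periods k e s -> mean_almost_periods k e t ->
  mean_almost_periods k e' (s - t).
Proof.
move=> pk ee' ms mt.
have bt : bounded_continuous (displacement k t).
  exact: displacement_bounded_continuous.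
(* The shift needs a strictly larger bound, and [2 * e < e'] gives [e < e' - e]. *)
have mt' : mean_below mu B (fun r => displacement k t (r + (t - s))) (e' - e).
  apply: mean_below_shift mt => // [r|]; first exact: pseudometric_ge0.
  lra.
apply: (mean_below_leD mu_haar B_folner (displacement_bounded_continuous _ pk)
  (displacement_bounded_continuous s pk) (bounded_continuous_shift _ bt) ms mt').
- move=> r; apply: le_trans (pseudometric_triangle pk _ (act (r - s) x) _) _.
  rewrite lerD2l /displacement (pseudometric_sym pk).
  by rewrite !opprB -addrA addrA -(addrA r) [t - s - t]addrAC subrr add0r addrA.
- by rewrite subrKC.
Qed.

(** Sort [G] by finite coverings for [k1] and [k2]: the difference of two points of one class is an
    almost period of both. *)
Lemma mean_almost_periodicD k1 k2 : continuous_pseudometric k1 ->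
  continuous_pseudometric k2 -> mean_almost_periodic_along k1 ->
  mean_almost_periodic_along k2 ->
  mean_almost_periodic_along (fun y z => k1 y z + k2 y z).
Proof.
move=> p1 p2 m1 m2 e e0; have e8 : 0 < e / 8 by rewrite divr_gt0.
apply: finitely_covering_relatively_dense.
have c1 := mean_almost_periods_finitely_covering p1 m1 e8.
have c2 := mean_almost_periods_finitely_covering p2 m2 e8.
apply: finitely_coveringI c1 c2 _ => a b s t s1 t1 s2 t2.
have e82 : 2 * (e / 8) < e / 2 by lra.
have := mean_almost_periodsB p1 e82 s1 t1.
have := mean_almost_periodsB p2 e82 s2 t2.
rewrite !opprB !addrA !subrK => h2 h1.
rewrite /mean_almost_periods /= [e]splitr.
by apply: mean_belowD => //; exact: displacement_bounded_continuous.
Qed.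

Lemma mean_almost_periodicZ k c : 0 < c -> continuous_pseudometric k ->
  mean_almost_periodic_along k ->
  mean_almost_periodic_along (fun y z => c * k y z).
Proof.
move=> c0 pk mk e e0; apply: relatively_denseS (mk (e / c) (divr_gt0 e0 c0)).
move=> t mt; rewrite /mean_almost_periods /= -[e](divfK (lt0r_neq0 c0)) mulrC.
by apply: mean_belowZ => //; exact: displacement_bounded_continuous.
Qed.

Lemma mean_almost_periodic0 : mean_almost_periodic_along (fun _ _ => 0).
Proof.
move=> e e0; apply: finitely_covering_relatively_dense; exists [:: 0] => t.
by exists 0; rewrite ?inE//; exact: mean_below_cst.
Qed.

Lemma mean_almost_periodic_sum (l : seq (R * (X -> X -> R))) :
  (forall p, p \in l -> [/\ 0 < p.1, continuous_pseudometric p.2 &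
    mean_almost_periodic_along p.2]) ->
  let k y z := \sum_(p <- l) p.1 * p.2 y z in
  continuous_pseudometric k /\ mean_almost_periodic_along k.
Proof.
elim: l => [_|p l IHl lP] /=.
  rewrite (_ : (fun y z => _) = fun _ _ => 0).
    by split; [exact: continuous_pseudometric0|exact: mean_almost_periodic0].
  by apply/funext => y; apply/funext => z; rewrite big_nil.
rewrite (_ : (fun y z => _) =
    fun y z => p.1 * p.2 y z + \sum_(p <- l) p.1 * p.2 y z); last first.
  by apply/funext => y; apply/funext => z; rewrite big_cons.
have [|pl ml] := IHl; first by move=> q ql; apply: lP; rewrite inE ql orbT.
have [p0 pp mp] := lP p (mem_head _ _).
have pZ := continuous_pseudometricZ (ltW p0) pp.
split; first exact: continuous_pseudometricD.
by apply: mean_almost_periodicD => //; exact: mean_almost_periodicZ.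
Qed.

(** With domination up to [e / 4], every [e / 2]-almost period of [k'] is an [e]-almost period of
    [k]; displacements involve orbit points only. *)
Lemma mean_almost_periodic_dominated k : continuous_pseudometric k ->
  (forall e, 0 < e -> exists k', [/\ continuous_pseudometric k',
    mean_almost_periodic_along k' &
    forall s t, k (act s x) (act t x) <= e + k' (act s x) (act t x)]) ->
  mean_almost_periodic_along k.
Proof.
move=> pk dom e e0; have e4 : 0 < e / 4 by rewrite divr_gt0.
have e2 : 0 < e / 2 by rewrite divr_gt0.
have e42 : e / 4 < e / 2 by lra.
have [k' [pk' mk' kk']] := dom _ e4; apply: relatively_denseS (mk' _ e2) => t mt.
apply: (mean_below_leD mu_haar B_folner (displacement_bounded_continuous _ pk)
  (bounded_continuous_cst (e / 4)) (displacement_bounded_continuous t pk')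
  (mean_below_cst B_folner (ltW e4) e42) mt).
- by move=> s; exact: kk'.
- by rewrite -splitr.
Qed.

(* Where [k] is at least [e], some member of the family is positive;
   by compactness finitely many of them, suitably scaled, dominate [k] there. *)
Theorem mean_almost_periodic_separating (F : set (X -> X -> R)) :
  (forall k, F k -> continuous_pseudometric k /\ mean_almost_periodic_along k) ->
  (forall y z, closure (action_orbit act x) y -> closure (action_orbit act x) z ->
    y <> z -> exists2 k, F k & k y z != 0) ->
  forall k, continuous_pseudometric k -> mean_almost_periodic_along k.
Proof.
move=> FP Fsep k pk; apply: mean_almost_periodic_dominated => // e e0.
set K := closure (action_orbit act x) in Fsep.
have [M M0 kM] := pseudometric_bounded X_compact pk.
pose C := [set p : X * X | [/\ K p.1, K p.2 & e <= k p.1 p.2]].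
have cC : compact C.
  have cXX : compact [set: X * X] by rewrite -setXTT; exact: compact_setX.
  apply: subclosed_compact cXX _ => //.
  rewrite (_ : C = (fst @^-1` K) `&` ((snd @^-1` K) `&`
    ((fun p => k p.1 p.2) @^-1` [set r | e <= r]))).
    apply: closedI; last apply: closedI.
    - by apply: preimage_closed; [move=> ? _; exact: cvg_fst|exact: closed_closure].
    - by apply: preimage_closed; [move=> ? _; exact: cvg_snd|exact: closed_closure].
    - apply: preimage_closed; last exact: closed_ge.
      by move=> p _; exact: pseudometric_continuous.
  by apply/seteqP; split => p /=; [case|move=> [? []]].
(* An index [(d, j)] stands for the open set of pairs at which [j] exceeds [d > 0]; these sets cover
   [C]. *)
pose D := [set i : R * (X -> X -> R) | 0 < i.1 /\ F i.2].
(* [compact_cover] is only available for pointed spaces. *)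
pose XX : ptopologicalType :=
  HB.pack (X * X)%type (isPointed.Build (X * X)%type (x, x)).
move: (cC : @compact XX C); rewrite compact_cover
  => /(_ _ D (fun i => [set p | i.1 < i.2 p.1 p.2])).
case.
- move=> [d j] [/= d0 Fj].
  rewrite -[X in open X]/((fun p : X * X => j p.1 p.2) @^-1` [set r | d < r]).
  apply: open_comp; last exact: open_gt.
  by move=> p _; apply: pseudometric_continuous; case: (FP _ Fj).
- move=> [y z] [/= Ky Kz ekyz].
  have [yz|j Fj jyz] := Fsep y z Ky Kz.
    by move: ekyz; rewrite yz (pseudometricxx pk) leNgt e0.
  have [pj mj] := FP _ Fj.
  have j0 : 0 < j y z by rewrite lt0r jyz pseudometric_ge0.
  exists (j y z / 2, j); first by split; rewrite ?divr_gt0.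
  by rewrite /= ltr_pdivrMr// ltr_pMr// ltr1n.
(* Weight [M / d] for [j]: where [j > d], the term [(M / d) * j] exceeds [M], hence [k]. *)
move=> E ED CE; pose l := [seq (M / i.1, i.2) | i <- finmap.enum_fset E].
have lP p : p \in l ->
    [/\ 0 < p.1, continuous_pseudometric p.2 & mean_almost_periodic_along p.2].
  move=> /mapP[i iE ->]; have /set_mem[/= i0 Fi] := ED _ iE.
  by have [pi mi] := FP _ Fi; split; rewrite ?divr_gt0.
have [pl ml] := mean_almost_periodic_sum lP.
eexists; split; [exact: pl|exact: ml|move=> s t /=].
have Korb r : K (act r x) by apply: subset_closure; exists r.
(* Below [e] nonnegativity of the sum is enough; otherwise the pair lies in [C] and one term of the
   sum dominates. *)
have [ke|ek] := ltP (k (act s x) (act t x)) e.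
  rewrite (le_trans (ltW ke))// lerDl; exact: (pseudometric_ge0 _ _ pl).
have [i iE /= ilt] := CE (act s x, act t x) (And3 (Korb s) (Korb t) ek).
have /set_mem[/= i0 Fi] := ED _ iE.
apply: (@le_trans _ _ M); first exact: kM.
apply: ler_wpDl; first exact: ltW.
rewrite big_map (big_rem i)//=; apply: ler_wpDr; last first.
  by rewrite mulrAC ler_pdivlMr// ler_pM2l// ltW.
rewrite big_seq sumr_ge0// => j /mem_rem jE.
have /set_mem[/= j0 Fj] := ED _ jE; have [pj _] := FP _ Fj.
by apply: mulr_ge0; [rewrite divr_ge0// ltW|exact: pseudometric_ge0].
Qed.

(** * From pseudometrics back to points and functions *)

Lemma mean_almost_periodic_alongP k :
  (forall e, 0 < e -> relatively_dense
    [set t | (upper_mean mu B (displacement k t) < e%:E)%E]) <->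
  mean_almost_periodic_along k.
Proof.
split=> mk e e0.
  by apply: relatively_denseS (mk e e0) => t; exact: upper_mean_lt.
have e2 : 0 < e / 2 by rewrite divr_gt0.
apply: relatively_denseS (mk _ e2) => t mt; apply: mean_below_upper_mean mt _.
lra.
Qed.

(** The mean distance from [x] to [t x] is the upper mean of the displacement by [- t], whence the
    reflection of the set. *)
Lemma mean_almost_periodic_pointP : mean_almost_periodic_point mu B act x <->
  mean_almost_periodic_along (fun y z => mdist y z).
Proof.
have distE t : mean_dist mu B act x (act t x) =
    upper_mean mu B (displacement (fun y z => mdist y z) (- t)).
  congr upper_mean; apply/funext => s.
  by rewrite /displacement opprK (actionD act_continuous).
rewrite -mean_almost_periodic_alongP.
split=> mx e e0; apply: relatively_denseS (relatively_denseN (mx e e0)) => t /=.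
  by rewrite distE opprK.
by rewrite distE.
Qed.

(** The almost periods agree by definition; boundedness and measurability come from compactness of
    [X] and continuity. *)
Lemma mean_almost_periodic_along_orbitP (f : X -> R[i]^o) : continuous f ->
  mean_almost_periodic_fun mu B (along_orbit act x f) <->
  mean_almost_periodic_along (modulus_kernel f).
Proof.
move=> cf; rewrite -mean_almost_periodic_alongP; split; first by case.
move=> mf; split=> //.
  have [M _ fM] :=
    pseudometric_bounded X_compact (continuous_pseudometric_modulus cf).
  exists (M + Normc.normc (f x)) => t.
  rewrite -[along_orbit _ _ _ _](subrK (f x)); apply: le_trans (le_normcD _ _) _.
  by rewrite lerD2r; exact: fM.
apply: continuous_borel_measurable => t.
apply: (@continuous_comp _ _ _ (act ^~ x) f); first exact: continuous_orbit_map.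
exact: cf.
Qed.

End MeanAlmostPeriods.

(** * Distance functions and the equivalence of the four assertions *)

Lemma continuous_complex_mdist (R : realType) (X : metricType R) (y : X) :
  continuous (fun z => (mdist y z)%:C%C : R[i]^o).
Proof.
(* Positivity in [R[i]] forces the imaginary part [e'] to be 0. *)
move=> z; apply/cvgrPdist_lt => -[e e']; rewrite ltcE /= => /andP[/eqP -> e0].
have : \forall z' \near z, mdist z z' < e.
  by have := nbhsx_ballx z e e0; rewrite ballEmdist.
apply: filterS => z' zz'; rewrite -rmorphB /=.
have h1 := metric_triangle y z z'; have h2 := metric_triangle y z' z.
rewrite (metric_sym z' z) in h2.
rewrite normc_def /= expr0n addr0 sqrtr_sqr ltcR ltr_norml.
by apply/andP; split; lra.
Qed.

Theorem lemma2p7 (R : realType) (G : topologicalZmodType)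
    (G_hausdorff : hausdorff_space G)
    (G_locally_compact : locally_compact [set: G])
    (G_sigma_compact : sigma_compact G)
    (mu : {measure set (borel G) -> \bar R}) (mu_haar : haar_measure mu)
    (X : metricType R) (X_compact : compact [set: X])
    (act : G -> X -> X) (act_continuous : continuous_action act)
    (B : (set G)^nat) (B_folner : folner_sequence mu B) (x : X) :
  [<-> mean_almost_periodic_point mu B act x;
       forall g, orbit_functions act x g -> mean_almost_periodic_fun mu B g;
       separates_points_of
         [set f | continuous_functions f /\
                  mean_almost_periodic_fun mu B (along_orbit act x f)]
         (closure (action_orbit act x));
       forall s : G,
         mean_almost_periodic_fun mu B (along_orbit act x (dist_from act x s))].
Proof.
have pointP := mean_almost_periodic_pointP mu B x act_continuous.
have funP f := @mean_almost_periodic_along_orbitP R G X mu B act x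
  X_compact act_continuous f.
have separating := @mean_almost_periodic_separating R G X mu B act x
  mu_haar B_folner X_compact act_continuous.
have distc s : continuous (dist_from act x s).
  exact: continuous_complex_mdist.
tfae.
(* (i) to (ii): the metric alone is a separating family. *)
- move=> /pointP mx _ [f cf <-]; apply/funP => //.
  apply: (separating [set fun y z => mdist y z]).
  + by move=> k ->; split; [exact: continuous_pseudometric_mdist|].
  + move=> y z _ _ yz; eexists; first by [].
    by apply/negP => /eqP /mdist_positivity.
  + exact: continuous_pseudometric_modulus.
(* (ii) to (iii): the distance from [y] separates [y] from [z]. *)
- move=> mA y z _ _ yz; exists (fun w => (mdist y w)%:C%C).
    have cy := @continuous_complex_mdist R X y.
    by split=> //; apply: mA; eexists; [exact: cy|].
  by rewrite mdistxx => -[/esym /mdist_positivity].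
(* (iii) to (iv): the kernels [|f y - f z|] of the given functions form a separating family. *)
- move=> sep s; apply/funP => //.
  apply: (separating [set modulus_kernel f | f in [set f | continuous_functions f /\
    mean_almost_periodic_fun mu B (along_orbit act x f)]]).
  + move=> _ [f [cf mf] <-]; split; first exact: continuous_pseudometric_modulus.
    exact/funP.
  + move=> y z Ky Kz yz; have [f Ff fyz] := sep y z Ky Kz yz.
    exists (modulus_kernel f); first by exists f.
    apply/negP => /eqP /Normc.eq0_normc /eqP; rewrite subr_eq0 => /eqP.
    exact: fyz.
  + exact: continuous_pseudometric_modulus.
(* (iv) to (i): the kernels of the distances from orbit points form a separating family. *)
- move=> md; apply/pointP.
  apply: (separating [set modulus_kernel (dist_from act x s) | s in setT]).
  + move=> _ [s _ <-]; split; first exact: continuous_pseudometric_modulus.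
    exact/funP.
  + move=> y z Ky _ /eqP; rewrite -mdist_gt0 => yz.
    (* Take an orbit point [s x] closer to [y] than half of [d(y, z)]; were it equidistant from [y]
       and [z], then [d(y, z) <= 2 d(s x, y) < d(y, z)]. *)
    have /Ky[_ [[s _ <-]]] := nbhsx_ballx y _ (divr_gt0 yz (ltr0n R 2)).
    rewrite ballEmdist /= => ys.
    exists (modulus_kernel (dist_from act x s)); first by exists s.
    rewrite /modulus_kernel /dist_from; apply/negP => /eqP /Normc.eq0_normc.
    move=> /eqP; rewrite subr_eq0 => /eqP [syz].
    have := metric_triangle y (act s x) z; rewrite -syz (metric_sym _ y).
    lra.
  + exact: continuous_pseudometric_mdist.
Qed.
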